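(* Let $\lambda,\mu,\alpha>0$ and let $\xi(t)$, $t\ge 0$, be the Poisson process with uniform catastrophes with parameters $\lambda,\mu,\alpha$ (defined in the context). Let $\varphi:(0,\infty)\to(0,\infty)$ be a function with $\varphi(T)\to\infty$ as $T\to\infty$, such that $\lim_{T\to\infty}\varphi(T)/T=0$ and there exists $a\in(0,1)$ with $\lim_{T\to\infty}\varphi(T)/T^a=\infty$. Then the family of random variables $\xi_T(1):=\xi(T)/\varphi(T)$ satisfies the large deviation principle on $\mathbb{R}$ with normalizing function $\psi(T)=\varphi(T)$ and rate function $$ I_1(x)=\begin{cases}\infty, & x\in(-\infty,0),\\ x\ln\left(\frac{\lambda+\mu}{\lambda}\right), & x\in[0,\infty).\end{cases} $$
   Context: Poisson process with uniform catastrophes: let $\eta(n)$, $n\in\mathbb{Z}^+=\{0,1,2,\dots\}$, be a Markov chain on $\mathbb{Z}^+$ with $\eta(0)=0$ and transition probabilities $\mathbf{P}(\eta(n+1)=j\mid\eta(n)=i)=\frac{\lambda}{\lambda+\mu}$ if $j=i+1$ (and $i\ge 1$), $=\frac{\mu}{i(\lambda+\mu)}$ if $0\le j<i$, $i\neq0$, and $=1$ if $i=0$, $j=1$. Let $\nu(t)$, $t\ge0$, be a Poisson process with rate $\alpha$, independent of $\eta$. Set $\xi(t):=\eta(\nu(t))$. Large deviation principle (LDP): a family of real random variables $X_T$ satisfies the LDP with rate function $I:\mathbb{R}\to[0,\infty]$ and normalizing function $\psi(T)\to\infty$ if for every $c\ge0$ the set $\{x: I(x)\le c\}$ is compact, and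 for every Borel set $B\subseteq\mathbb{R}$, $\limsup_{T\to\infty}\frac{1}{\psi(T)}\ln\mathbf{P}(X_T\in B)\le -I([B])$ and $\liminf_{T\to\infty}\frac{1}{\psi(T)}\ln\mathbf{P}(X_T\in B)\ge -I((B))$, where $[B]$ and $(B)$ denote closure and interior, $I(B)=\inf_{x\in B}I(x)$ and $I(\emptyset)=\infty$. *)

(* Defs.v *)
From HB Require Import structures.
From mathcomp Require Import all_boot all_order all_algebra.
From mathcomp Require Import all_classical all_reals all_analysis.
Set Implicit Arguments. Unset Strict Implicit. Unset Printing Implicit Defensive.
Import Order.TTheory GRing.Theory Num.Def Num.Theory.
Import numFieldNormedType.Exports.
Local Open Scope classical_set_scope.
Local Open Scope ring_scope.

Section PoissonCatastrophes.
Variable R : realType.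
Variables lam mu alpha : R.

Definition eta_trans (i j : nat) : R :=
  if i == 0%N then (if j == 1%N then 1 else 0)
  else if j == i.+1 then lam / (lam + mu)
  else if (j < i)%N then mu / (i%:R * (lam + mu))
  else 0.

(* eta_dist n j = P(eta(n) = j), with eta(0) = 0.
   Since eta(n) <= n, only states i <= n contribute at step n. *)
Fixpoint eta_dist (n : nat) : nat -> R :=
  match n with
  | 0%N => fun j => if j == 0%N then 1 else 0
  | n'.+1 => fun j => \sum_(i < n'.+1) eta_dist n' i * eta_trans i j
  end.

(* xi_dist t k = P(xi(t) = k) = P(eta(nu(t)) = k), nu a Poisson process of
   rate alpha independent of eta (so nu(t) ~ Poisson(alpha t)). *)
Definition xi_dist (t : R) (k : nat) : \bar R :=
  (\sum_(0 <= n <oo)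
     (expR (- (alpha * t)) * (alpha * t) ^+ n / n`!%:R * eta_dist n k)%:E)%E.

Definition xiT_prob (phi : R -> R) (T : R) (B : set R) : \bar R :=
  (\sum_(0 <= k <oo | ((k%:R / phi T)%R \in B)) xi_dist T k)%E.

End PoissonCatastrophes.

Definition eln {R : realType} (x : \bar R) : \bar R :=
  match x with
  | r%:E => if (0 < r)%R then (ln r)%:E else -oo
  | +oo => +oo
  | -oo => -oo
  end%E.

Definition LDP {R : realType} (P : R -> set R -> \bar R) (psi : R -> R)
    (I : R -> \bar R) : Prop :=
  (forall x, (0 <= I x)%E) /\
  (forall c : R, 0 <= c -> compact [set x | (I x <= c%:E)%E]) /\
  (forall B : set R, measurable B ->
     (limf_esup (fun T => (psi T)^-1%:E * eln (P T B))%E (pinfty_nbhs R)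
        <= - ereal_inf (I @` closure B))%E /\
     (- ereal_inf (I @` interior B)
        <= limf_einf (fun T => (psi T)^-1%:E * eln (P T B))%E (pinfty_nbhs R))%E).

Definition I1 {R : realType} (lam mu : R) (x : R) : \bar R :=
  if x < 0 then +oo%E else (x * ln ((lam + mu) / lam))%:E.

(* Main.v *)
(** Let [q = lam / (lam + mu)] and [L = - ln q]. For every [r] in [(q, 1)] the
    geometric sequence [C r^j] dominates the law of eta(n) uniformly in [n], so
    xi(T) has exponential tails of every rate below [L], uniformly in [T]. This
    gives the upper bound, and it also gives tightness: at every time a fixed
    amount of mass sits on the states 0 and 1. From there the chain climbs [k]
    steps with probability at least [q^k]. As [phi T = o(T)], the Poisson clock
    has rung more than [x phi(T)] times with probability at least 1/2, so xi(T)
    reaches the level [x phi(T)] with probability at least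
    [c exp(- L x phi(T))]. *)
Require Import Defs.
From HB Require Import structures.
From mathcomp Require Import all_boot all_order all_algebra.
From mathcomp Require Import all_classical all_reals all_analysis.
From mathcomp Require Import ring lra.
Import Order.TTheory GRing.Theory Num.Def Num.Theory.
Import numFieldNormedType.Exports.
Local Open Scope classical_set_scope.
Local Open Scope ring_scope.

(** * The law of the embedded chain eta(n): geometric upper bound and climbing lower bound *)

Section Chain.
Variables (R : realType) (lam mu : R).
Hypotheses (lam_gt0 : 0 < lam) (mu_gt0 : 0 < mu).

Let p := mu / (lam + mu).
Let q := lam / (lam + mu).

Let lammu_gt0 : 0 < lam + mu. Proof. exact: addr_gt0. Qed.
Let p_gt0 : 0 < p. Proof. exact: divr_gt0. Qed.
Let q_gt0 : 0 < q. Proof. exact: divr_gt0. Qed.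
Let pq1 : p + q = 1.
Proof. by rewrite -mulrDl addrC divff// gt_eqF. Qed.

Lemma eta_trans_gt0E i j : i != 0%N ->
  eta_trans lam mu i j =
    (if j == i.+1 then q else 0) + (if (j < i)%N then p / i%:R else 0).
Proof.
move=> i0; rewrite /eta_trans (negbTE i0).
case: eqP => [->|_]; first by rewrite ltnNge leqW//= addr0.
by rewrite add0r; case: ifP => // _; rewrite /p invfM mulrA mulrAC.
Qed.

Lemma eta_trans_ge0 i j : 0 <= eta_trans lam mu i j.
Proof.
have [->|i0] := eqVneq i 0%N; first by (rewrite /eta_trans /=; case: ifP).
rewrite eta_trans_gt0E//; apply: addr_ge0; case: ifP => // _.
  exact: ltW.
by rewrite divr_ge0// ltW.
Qed.

Lemma sum_eta_trans i n : (i <= n)%N ->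
  \sum_(j < n.+2) eta_trans lam mu i j = 1.
Proof.
move=> lein; have [->|i0] := eqVneq i 0%N.
  by rewrite big_ord_recl big_ord_recl /eta_trans/= big1// addr0 add0r.
under eq_bigr do rewrite eta_trans_gt0E//.
rewrite big_split/= -!big_mkcond/=.
rewrite -(big_ord_widen n.+2 (fun=> p / i%:R)) ?(leq_trans lein)//; last first.
  by rewrite -addn2 leq_addr.
have lt_i1 : (i.+1 < n.+2)%N by [].
rewrite (big_pred1 (Ordinal lt_i1))// big_const_ord iter_addr_0.
by rewrite -[X in _ + X]mulr_natr divfK ?pnatr_eq0// addrC.
Qed.

Lemma eta_dist_ge0 n j : 0 <= eta_dist lam mu n j.
Proof.
case: n j => [|n]; first by (move=> j /=; case: ifP).
elim: n => [|n IHn] j; rewrite /= sumr_ge0// => i _; rewrite mulr_ge0//.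
- by rewrite /=; case: ifP.
- exact: eta_trans_ge0.
- exact: IHn.
- exact: eta_trans_ge0.
Qed.

Lemma sum_eta_dist n : \sum_(j < n.+1) eta_dist lam mu n j = 1.
Proof.
elim: n => [|n IHn]; first by rewrite big_ord1.
rewrite /= exchange_big/= -[RHS]IHn; apply: eq_bigr => i _.
by rewrite -mulr_sumr sum_eta_trans ?mulr1// -ltnS.
Qed.

Lemma eta_dist_gt n j : (n < j)%N -> eta_dist lam mu n j = 0.
Proof.
case: n => [|n] ltnj /=; first by rewrite gtn_eqF.
rewrite big1// => i _; rewrite /eta_trans.
have lti := ltn_ord i.
have [i0|i0] := eqVneq (i : nat) 0%N.
  by rewrite gtn_eqF ?mulr0// (leq_trans _ ltnj).
rewrite gtn_eqF; last by rewrite (leq_ltn_trans _ ltnj).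
by rewrite ltnNge ltnW ?mulr0// (ltn_trans lti)// ltnW.
Qed.

Lemma eta_dist_le1 n j : eta_dist lam mu n j <= 1.
Proof.
have [lenj|ltnj] := leqP j n; last by rewrite eta_dist_gt.
rewrite -(sum_eta_dist n) (bigD1 (Ordinal (lenj : (j < n.+1)%N)))//= lerDl.
by rewrite sumr_ge0// => i _; exact: eta_dist_ge0.
Qed.

Lemma sum_geometric_le (r : R) m n : 0 < r < 1 ->
  \sum_(i < n | (m <= i)%N) r ^+ i <= r ^+ m / (1 - r).
Proof.
move=> /andP[r0 r1].
rewrite -(big_mkord (leq m) (fun i => r ^+ i)).
have [lemn|ltnm] := leqP m n; last first.
  rewrite big_nat_cond big1 ?divr_ge0 ?exprn_ge0 ?subr_ge0 ?ltW// => i.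
  move=> /andP[/andP[_ ltin] lemi].
  by have := leq_ltn_trans lemi (ltn_trans ltin ltnm); rewrite ltnn.
rewrite (big_cat_nat (leq0n m) lemn)/= [X in X + _]big_nat_cond big1 ?add0r; last first.
  by move=> i; rewrite ltnNge andbC => /andP[->].
apply: (@le_trans _ _ (\sum_(m <= i < m + (n - m)) r ^+ i)).
  rewrite subnKC// [leRHS](bigID (leq m))/= lerDl sumr_ge0// => i _.
  by rewrite exprn_ge0// ltW.
by rewrite geometric_partial_tail geometric_le_lim ?exprn_ge0 ?ltW ?ger0_norm ?ltW.
Qed.

(* The sequence [r ^+ j] is superharmonic for the transposed chain once [j] is
   large: jumps contribute [q / r < 1] and catastrophes only [O(1 / j)]. *)
Lemma eta_dist_geometric (r : R) : lam / (lam + mu) < r < 1 ->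
  exists2 C : R, 0 < C & forall n j, eta_dist lam mu n j <= C * r ^+ j.
Proof.
move=> /andP[ltqr ltr1]; have r0 : 0 < r by exact: lt_trans ltqr.
(* [J] solves [p / j.+1 * (r / (1 - r)) <= 1 - q / r] for all [j >= J], so catastrophes fit in the
   room left by the up-step. Being a successor, it also forces [j >= 1] wherever [J <= j]. *)
pose J := (truncn (p * (r / (1 - r)) / (1 - q / r))).+1.
have qr : 0 < 1 - q / r by rewrite subr_gt0 ltr_pdivrMr// mul1r.
have J_large j : (J <= j)%N -> q / r + p / j.+1%:R * (r / (1 - r)) <= 1.
  move=> leJj; rewrite -lerBrDl mulrAC ler_pdivrMr ?ltr0n//.
  rewrite -ler_pdivrMl// mulrC (le_trans (ltW (truncnS_gt _)))//.
  by rewrite ler_nat -/J ltnW.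
(* With this constant the bound is at least 1 at every level [j <= J], hence trivial there; only
   levels above [J] need the induction on [n]. *)
exists (r ^+ J)^-1; first by rewrite invr_gt0 exprn_gt0.
have small n j : (j <= J)%N -> eta_dist lam mu n j <= (r ^+ J)^-1 * r ^+ j.
  move=> lejJ; rewrite mulrC ler_pdivlMr ?exprn_gt0//.
  apply: (@le_trans _ _ (1 * r ^+ J)).
    by rewrite ler_wpM2r ?eta_dist_le1// exprn_ge0// ltW.
  by rewrite mul1r ler_wiXn2l ?ltW.
elim=> [|n IHn] j; (have [lejJ|ltJj] := leqP j J; first exact: small).
  rewrite eta_dist_gt ?(leq_ltn_trans _ ltJj)//.
  by rewrite mulr_ge0 ?invr_ge0 ?exprn_ge0 ?ltW.
case: j ltJj => // j; rewrite ltnS => leJj.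
set C := (r ^+ J)^-1; have C0 : 0 < C by rewrite invr_gt0 exprn_gt0.
(* State [j.+1] is entered by the up-step from [j] or by a catastrophe from [i >= j.+2]. Replacing
   [1 / i] by [1 / j.+1] turns the catastrophe part into a geometric tail. The sure jump from 0 to 1
   never interferes, as [j >= J >= 1]. *)
have termC (i : 'I_n.+1) : eta_dist lam mu n i * eta_trans lam mu i j.+1 <=
    (if i == j :> nat then C * q * r ^+ j else 0) +
    (if (j.+2 <= i)%N then C * (p / j.+1%:R) * r ^+ i else 0).
  have [i0|i0] := eqVneq (i : nat) 0%N.
    rewrite i0 /eta_trans/= [j.+1 == 1%N]gtn_eqF ?mulr0 ?addr0//.
      by case: ifP => // _; apply/ltW/mulr_gt0; [exact: mulr_gt0 | exact: exprn_gt0].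
    by rewrite ltnS (leq_trans _ leJj).
  rewrite eta_trans_gt0E// mulrDr eqSS eq_sym; apply: lerD.
    case: eqP => [->|_]; last by rewrite mulr0.
    by rewrite [leRHS]mulrAC ler_wpM2r ?IHn// ltW.
  case: ifP => [ltji|_]; last by rewrite mulr0.
  have i_gt0 : 0 < i%:R :> R by rewrite ltr0n lt0n.
  rewrite [leRHS]mulrAC; apply: ler_pM; rewrite ?eta_dist_ge0 ?IHn//.
    by rewrite ltW// divr_gt0.
  by rewrite ler_pM2l// lef_pV2 ?posrE ?ltr0n ?lt0n// ler_nat ltnW.
rewrite [leLHS]/=; apply: le_trans (ler_sum _ (fun i _ => termC i)) _.
rewrite big_split/= -!big_mkcond/= -[X in _ + X]mulr_sumr.
apply: (@le_trans _ _ (C * q * r ^+ j + C * (p / j.+1%:R) * (r ^+ j.+2 / (1 - r)))).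
  apply: lerD; last first.
    rewrite ler_wpM2l ?sum_geometric_le ?r0//.
    by apply/ltW/mulr_gt0; rewrite ?divr_gt0 ?ltr0n.
  have [lejn|ltnj] := leqP j n.
    by rewrite (big_pred1 (Ordinal (lejn : (j < n.+1)%N))).
  rewrite big1 => [|i]; first by apply/ltW/mulr_gt0; [exact: mulr_gt0 | exact: exprn_gt0].
  move=> /eqP ij.
  by move: (ltn_ord i); rewrite ij ltnS leqNgt ltnj.
have -> : C * q * r ^+ j + C * (p / j.+1%:R) * (r ^+ j.+2 / (1 - r)) =
  C * r ^+ j.+1 * (q / r + p / j.+1%:R * (r / (1 - r))).
  rewrite !exprS; field.
  by rewrite subr_eq0 !gt_eqF//= nat1r ltr0n.
by rewrite ler_piMr ?J_large// mulr_ge0 ?exprn_ge0 ?ltW.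
Qed.

(* Neither state alone is bounded below by one-step estimates, since 0 is left
   with probability 1; a low state other than 0 falls to 0, and 0 moves to 1. *)
Lemma eta_dist_low : exists2 c : R, 0 < c &
  forall n, c <= eta_dist lam mu n 0 + eta_dist lam mu n 1.
Proof.
have q1 : q < 1 by rewrite -pq1 ltrDr.
have p1 : p < 1 by rewrite -pq1 ltrDl.
pose r := (q + 1) / 2.
have [ltqr ltr1] : q < r /\ r < 1 by rewrite /r; split; lra.
have r0 : 0 < r by exact: lt_trans ltqr.
have [|C C0 leC] := @eta_dist_geometric r; first by rewrite ltqr.
(* By the geometric bound the states [i >= K] carry mass at most 1/2 at every time. The others thus
   carry at least 1/2, and each of them enters {0, 1} in one step with probability at least
   [p / K]. *)
have [K K0 KP] : exists2 K, (0 < K)%N & C * (r ^+ K / (1 - r)) <= 1 / 2.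
  have e0 : 0 < (1 - r) / C / 2 by rewrite !divr_gt0// subr_gt0.
  have /cvgrPdist_lt/(_ _ e0)[N _ /(_ N.+1 (leqnSn N))] : geometric 1 r n @[n --> \oo] --> 0.
    by apply: cvg_geometric; rewrite gtr0_norm.
  rewrite /= sub0r normrN mul1r gtr0_norm ?exprn_gt0// => /ltW rN.
  exists N.+1 => //; rewrite mulrA ler_pdivrMr ?subr_gt0// -ler_pdivlMl//.
  by rewrite (le_trans rN)//; lra.
have K0' : 0 < K%:R :> R by rewrite ltr0n.
have pK1 : p / K%:R <= 1.
  by rewrite ler_pdivrMr// mul1r (le_trans (ltW p1))// ler1n.
have c0 : 0 < p / K%:R by rewrite divr_gt0.
exists (p / K%:R / 2); first by rewrite divr_gt0.
case=> [|n]; first by rewrite /= addr0; lra.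
have jump i : (i < K)%N -> p / K%:R <= eta_trans lam mu i 0 + eta_trans lam mu i 1.
  move=> ltiK; rewrite (@le_trans _ _ (if i == 0%N then 1 else p / i%:R))//.
    case: eqVneq => // i0.
    have i_gt0 : 0 < i%:R :> R by rewrite ltr0n lt0n.
    by rewrite ler_pM2l// lef_pV2 ?posrE// ler_nat ltnW.
  have [->|i0] := eqVneq i 0%N; first by rewrite /eta_trans/= add0r.
  by rewrite (eta_trans_gt0E i 0)//= lt0n i0 add0r lerDl eta_trans_ge0.
rewrite /= -big_split/=.
under eq_bigr do rewrite -mulrDr.
apply: (@le_trans _ _ (\sum_(i < n.+1 | (i < K)%N) eta_dist lam mu n i * (p / K%:R))).
  rewrite -mulr_suml mulrC ler_wpM2r ?(ltW c0)//.
  have := sum_eta_dist n; rewrite (bigID (fun i : 'I_n.+1 => (i < K)%N))/= => mass.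
  have tail : \sum_(i < n.+1 | ~~ (i < K)%N) eta_dist lam mu n i <= 1 / 2.
    apply: le_trans KP; apply: (@le_trans _ _ (\sum_(i < n.+1 | (K <= i)%N) C * r ^+ i)).
      under eq_bigl do rewrite -leqNgt.
      by apply: ler_sum => i _; exact: leC.
    by rewrite -mulr_sumr ler_wpM2l ?(ltW C0)// sum_geometric_le// r0.
  by rewrite -div1r; lra.
rewrite [leRHS](bigID (fun i : 'I_n.+1 => (i < K)%N))/=.
rewrite -[leLHS]addr0 lerD//.
  by apply: ler_sum => i ltiK; rewrite ler_wpM2l ?eta_dist_ge0 ?jump.
by rewrite sumr_ge0// => i _; rewrite mulr_ge0 ?addr_ge0 ?eta_dist_ge0 ?eta_trans_ge0.
Qed.

(** Only the up-step from [j] is kept among the ways into [j.+1]; from state 0 its probability is 1,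
    still at least [q]. *)
Lemma eta_dist_up n j :
  lam / (lam + mu) * eta_dist lam mu n j <= eta_dist lam mu n.+1 j.+1.
Proof.
have [lejn|ltnj] := leqP j n; last first.
  by rewrite (eta_dist_gt _ _ ltnj) mulr0 eta_dist_ge0.
rewrite [leRHS]/= (bigD1 (Ordinal (lejn : (j < n.+1)%N)))//=.
rewrite (@le_trans _ _ (eta_dist lam mu n j * eta_trans lam mu j j.+1))//.
  rewrite mulrC ler_wpM2l ?eta_dist_ge0// /eta_trans eqxx eqSS.
  by case: (j == 0%N) => //; rewrite -pq1 lerDr ltW.
by rewrite lerDl sumr_ge0// => i _; rewrite mulr_ge0 ?eta_dist_ge0 ?eta_trans_ge0.
Qed.

(** At time [n - k] the states 0 and 1 together have mass at least [c] by [eta_dist_low]; each of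
    the remaining [k] steps lifts this pair one level at the price of a factor [q]. *)
Lemma eta_dist_lower : exists2 c : R, 0 < c & forall n k, (k <= n)%N ->
  c * (lam / (lam + mu)) ^+ k <= eta_dist lam mu n k + eta_dist lam mu n k.+1.
Proof.
have [c c0 low] := eta_dist_low; exists c => // n k; elim: k n => [|k IHk] n.
  by rewrite expr0 mulr1 => _; exact: low.
case: n => // n; rewrite ltnS => /IHk le_cq.
apply: (@le_trans _ _ (q * (eta_dist lam mu n k + eta_dist lam mu n k.+1))).
  by rewrite exprS mulrCA ler_wpM2l ?(ltW q_gt0).
by rewrite mulrDr lerD// eta_dist_up.
Qed.

End Chain.

(** * Tails of the Poisson clock *)

Section Poisson.
Context {R : realType}.
Implicit Types (x : R) (k n : nat).

Lemma sum_poisson_pmf x : 0 < x ->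
  (\sum_(0 <= n <oo) (poisson_pmf x n)%:E = 1)%E.
Proof.
move=> x0; have := @probability_setT _ _ R (poisson_prob x 0%N).
rewrite /= /poisson_prob x0 -nneseries_esumT// => n.
by rewrite lee_fin poisson_pmf_ge0.
Qed.

(* Chernoff bound: on [n < k] one has [1 <= 2 ^+ (k - n)], and
   [x ^+ n = 2 ^+ n * (x / 2) ^+ n] compares with the law of rate [x / 2]. *)
Lemma poisson_pmf_lower_tail x k : 0 < x ->
  \sum_(0 <= n < k) poisson_pmf x n <= 2 ^+ k * expR (- (x / 2)).
Proof.
move=> x0; have x20 : 0 < x / 2 by rewrite divr_gt0.
apply: (@le_trans _ _
    (2 ^+ k * expR (- (x / 2)) * \sum_(0 <= n < k) poisson_pmf (x / 2) n)).
  rewrite mulr_sumr; apply: ler_sum_nat => n /andP[_ ltnk].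
  have -> : poisson_pmf x n =
      2 ^+ n * (expR (- (x / 2)) * poisson_pmf (x / 2) n).
    rewrite /poisson_pmf x0 x20 (_ : - x = - (x / 2) + - (x / 2)); last by lra.
    rewrite expRD (_ : x ^+ n = 2 ^+ n * (x / 2) ^+ n); first by ring.
    by rewrite -exprMn mulrC divfK.
  rewrite -mulrA ler_wpM2r ?mulr_ge0 ?expR_ge0 ?poisson_pmf_ge0//.
  by rewrite ler_weXn2l ?ler1n// ltnW.
rewrite ler_piMr ?mulr_ge0 ?exprn_ge0 ?expR_ge0//.
rewrite -lee_fin -(sum_poisson_pmf _ x20) -sumEFin.
by apply: nneseries_lim_ge => n _ _; rewrite lee_fin poisson_pmf_ge0.
Qed.

Lemma poisson_pmf_upper_tail x k : 0 < x ->
  ((1 - 2 ^+ k * expR (- (x / 2)))%:E <=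
    \sum_(k <= n <oo) (poisson_pmf x n)%:E)%E.
Proof.
move=> x0; have := sum_poisson_pmf _ x0.
rewrite (nneseries_split 0 k) => [|n _]; last by rewrite lee_fin poisson_pmf_ge0.
rewrite add0n sumEFin => total.
rewrite EFinB leeBlDl// -total leeD2r// lee_fin.
exact: poisson_pmf_lower_tail.
Qed.

End Poisson.

(** * Non-asymptotic bounds for xi(T) and for the rescaled variable *)

Section Tails.
Variables (R : realType) (lam mu alpha : R).
Hypotheses (lam_gt0 : 0 < lam) (mu_gt0 : 0 < mu) (alpha_gt0 : 0 < alpha).

Let eta_ge0 n j : 0 <= eta_dist lam mu n j.
Proof. exact: eta_dist_ge0. Qed.

Lemma xi_distE T k : 0 < T -> xi_dist lam mu alpha T k =
  (\sum_(0 <= n <oo) (poisson_pmf (alpha * T) n * eta_dist lam mu n k)%:E)%E.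
Proof.
move=> T0; apply: eq_eseriesr => n _; rewrite /poisson_pmf mulr_gt0//.
by congr (_ * _)%:E; ring.
Qed.

Lemma xi_dist_ge0 T k : 0 < T -> (0 <= xi_dist lam mu alpha T k)%E.
Proof.
move=> T0; rewrite xi_distE//; apply: nneseries_ge0 => n _ _.
by rewrite lee_fin mulr_ge0 ?poisson_pmf_ge0.
Qed.

(** The law of xi(T) averages the laws of eta(n) with Poisson weights of total mass 1, so a bound
    uniform in [n] survives for every [T]. *)
Lemma xi_dist_le T k (M : R) : 0 < T ->
  (forall n, eta_dist lam mu n k <= M) -> (xi_dist lam mu alpha T k <= M%:E)%E.
Proof.
move=> T0 leM; rewrite xi_distE//.
rewrite -[leRHS]mule1 -(sum_poisson_pmf _ (mulr_gt0 alpha_gt0 T0)).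
rewrite -nneseriesZl => [|n _]; last by rewrite lee_fin poisson_pmf_ge0.
apply: lee_nneseries => n _; first by rewrite lee_fin mulr_ge0 ?poisson_pmf_ge0.
by rewrite -EFinM lee_fin mulrC ler_wpM2r ?poisson_pmf_ge0.
Qed.

(** Only clock values [n >= k] are kept, where [eta_dist_lower] applies; the last factor bounds
    their Poisson weight from below. *)
Lemma xi_dist_lower : exists2 c : R, 0 < c & forall T k, 0 < T ->
  ((c * (lam / (lam + mu)) ^+ k * (1 - 2 ^+ k * expR (- (alpha * T / 2))))%:E <=
    xi_dist lam mu alpha T k + xi_dist lam mu alpha T k.+1)%E.
Proof.
have [c c0 low] := eta_dist_lower _ _ _ lam_gt0 mu_gt0; exists c => // T k T0.
have ge0 j n : (0 <= (poisson_pmf (alpha * T) n * eta_dist lam mu n j)%:E)%E.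
  by rewrite lee_fin mulr_ge0 ?poisson_pmf_ge0.
rewrite !xi_distE// -nneseriesD//.
rewrite (nneseries_split 0 k) => [|n _]; last by rewrite adde_ge0.
rewrite add0n -[leLHS]add0e leeD//.
  by apply: sume_ge0 => n _; rewrite adde_ge0.
rewrite EFinM; set a := c * _.
have a0 : 0 <= a by rewrite mulr_ge0 ?exprn_ge0 ?divr_ge0 ?addr_ge0 ?ltW.
apply: le_trans (lee_wpmul2l _ (poisson_pmf_upper_tail _ k (mulr_gt0 alpha_gt0 T0))) _.
  by rewrite lee_fin.
rewrite -nneseriesZl => [|n _]; last by rewrite lee_fin poisson_pmf_ge0.
rewrite [leLHS]eseries_cond [leRHS]eseries_cond.
apply: lee_nneseries => n; last move=> /= lekn.
  by rewrite mule_ge0 ?lee_fin ?poisson_pmf_ge0.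
rewrite -EFinD -EFinM lee_fin -mulrDr mulrC.
by rewrite ler_wpM2l ?poisson_pmf_ge0// low.
Qed.

(** Since [d] is below the critical rate, a ratio [r] fits strictly between [q] and [expR (- d)].
    For [k >= x0 * phi T], [r ^+ k] is at most [expR (- (d * x0 * phi T))] times [s ^+ k], where
    [s = r * expR d < 1] keeps the series summable. *)
Lemma xiT_prob_upper (phi : R -> R) (d : R) :
  0 < d < ln ((lam + mu) / lam) ->
  exists2 C : R, 0 < C & forall T (B : set R) x0, 0 < T -> 0 < phi T ->
    (forall x, B x -> 0 <= x -> x0 <= x) ->
    (xiT_prob lam mu alpha phi T B <= (C * expR (- (d * x0 * phi T)))%:E)%E.
Proof.
move=> /andP[d0 ltd].
set q := lam / (lam + mu).
have q0 : 0 < q by rewrite divr_gt0 ?addr_gt0.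
have lt_q : q < expR (- d).
  rewrite expRN /q -[ltLHS]invrK ltf_pV2 ?posrE ?expR_gt0 ?invr_gt0//.
  by rewrite invf_div -[ltRHS]lnK ?posrE ?divr_gt0 ?addr_gt0// ltr_expR.
have [r ltqr ltr] : exists2 r, q < r & r < expR (- d).
  by exists ((q + expR (- d)) / 2); lra.
have r0 : 0 < r by exact: lt_trans ltqr.
have [|C C0 leC] := @eta_dist_geometric _ _ _ lam_gt0 mu_gt0 r.
  by rewrite ltqr (lt_trans ltr)// expR_lt1 oppr_lt0.
pose s := r * expR d.
have s0 : 0 < s by rewrite mulr_gt0 ?expR_gt0.
have s1 : s < 1.
  by rewrite /s -(mulVf (lt0r_neq0 (expR_gt0 d))) ltr_pM2r ?expR_gt0// -expRN.
exists (C / (1 - s)); first by rewrite divr_gt0 ?subr_gt0.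
move=> T B x0 T0 phi0 Bx0; rewrite /xiT_prob.
set e := expR _.
have Ce0 : 0 < C * e by rewrite mulr_gt0 ?expR_gt0.
apply: (@le_trans _ _ (\sum_(0 <= k <oo | (k%:R / phi T)%R \in B)
                          (C * e * s ^+ k)%:E)%E).
  apply: lee_nneseries => [k _ _|k]; first exact: xi_dist_ge0.
  rewrite inE => /Bx0; rewrite divr_ge0 ?(ltW phi0)// ler_pdivlMr// => /(_ isT) lek.
  apply: xi_dist_le => // n; apply: (le_trans (leC n k)).
  rewrite -mulrA ler_pM2l// /s exprMn mulrCA ler_peMr ?exprn_ge0 ?(ltW r0)//.
  rewrite -expRM_natl -expRD -[leLHS]expR0 ler_expR addrC subr_ge0 -mulrA [leRHS]mulrC.
  by rewrite ler_pM2l.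
apply: (@le_trans _ _ (\sum_(0 <= k <oo) (C * e * s ^+ k)%:E)%E).
  apply: subset_lee_nneseries => // k _.
  by rewrite lee_fin mulr_ge0 ?exprn_ge0 ?ltW.
have cvgs : series (geometric (C * e) s) n @[n --> \oo] --> C * e / (1 - s).
  by apply: cvg_geometric_series; rewrite gtr0_norm.
rewrite (_ : (fun _ => _) = EFin \o series (geometric (C * e) s)); last first.
  by apply/funext => n; rewrite /= -sumEFin.
rewrite EFin_lim; last by apply/cvg_ex; exists (C * e / (1 - s)).
by rewrite (cvg_lim _ cvgs)// lee_fin mulrAC.
Qed.

(** Two neighbouring lattice points must lie in [B] because [xi_dist_lower] controls only the sum of
    two consecutive masses. *)
Lemma xiT_prob_lower (phi : R -> R) : exists2 c : R, 0 < c &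
  forall T (B : set R) k, 0 < T ->
    B (k%:R / phi T) -> B (k.+1%:R / phi T) ->
  ((c * (lam / (lam + mu)) ^+ k * (1 - 2 ^+ k * expR (- (alpha * T / 2))))%:E <=
    xiT_prob lam mu alpha phi T B)%E.
Proof.
have [c c0 low] := xi_dist_lower; exists c => // T B k T0 Bk Bk1.
have xi0 j : (0 <= xi_dist lam mu alpha T j)%E by exact: xi_dist_ge0.
apply: (le_trans (low T k T0)); rewrite /xiT_prob.
rewrite (@nneseriesD1 _ _ k)//; last exact/mem_set.
rewrite (@nneseriesD1 _ _ k.+1)//; last first.
  by rewrite (gtn_eqF (ltnSn k)) andbT; exact/mem_set.
by rewrite addeA leeDl// nneseries_ge0.
Qed.

End Tails.

(** * Epsilon criteria for upper and lower limits at infinity *)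

Section Limits.
Context {R : realType}.
Local Open Scope ereal_scope.

Lemma le_eln (x y : \bar R) : x <= y -> eln x <= eln y.
Proof.
case: x => [x| |]; case: y => [y| |] //=; rewrite ?leey ?leNye//.
rewrite lee_fin => lexy; case: ifPn => [x0|_]; last by rewrite leNye.
have y0 : (0 < y)%R by exact: lt_le_trans lexy.
by rewrite y0 lee_fin ler_ln.
Qed.

(** The set where [f T <= l + e] belongs to the filter, so the supremum of [f] over it is one of the
    values whose infimum is [limf_esup]. *)
Lemma limf_esup_pinfty_le (f : R -> \bar R) (l : \bar R) :
  (forall e : R, (0 < e)%R -> \forall T \near +oo%R, f T <= l + e%:E) ->
  limf_esup f (pinfty_nbhs R) <= l.
Proof.
move=> fl; apply/lee_addgt0Pr => e e0.
apply: (@le_trans _ _ (ereal_sup (f @` [set T | f T <= l + e%:E]))).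
  by apply: ereal_inf_lbound; exists [set T | f T <= l + e%:E] => //; exact: fl.
by apply: ge_ereal_sup => _ [T fT <-].
Qed.

Lemma limf_einf_pinfty_ge (f : R -> \bar R) (l : R) :
  (forall e : R, (0 < e)%R -> \forall T \near +oo%R, (l - e)%:E <= f T) ->
  l%:E <= limf_einf f (pinfty_nbhs R).
Proof.
move=> fl; rewrite /limf_einf/= leeNr; apply: limf_esup_pinfty_le => e e0.
apply: filterS (fl e e0) => T lefT.
by rewrite -EFinN -EFinD leeNl -EFinN opprD opprK.
Qed.

End Limits.

(** * The large deviation principle: compact level sets, upper bound, lower bound *)

Theorem theorem2p3 (R : realType) (lam mu alpha : R) (phi : R -> R) :
  0 < lam -> 0 < mu -> 0 < alpha ->
  (forall T, 0 < T -> 0 < phi T) ->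
  phi x @[x --> +oo] --> +oo ->
  (fun T => phi T / T) x @[x --> +oo] --> 0 ->
  (exists2 a : R, 0 < a < 1 & (fun T => phi T / T `^ a) x @[x --> +oo] --> +oo) ->
  LDP (xiT_prob lam mu alpha phi) phi (I1 lam mu).
Proof.
move=> lam0 mu0 alpha0 phi_gt0 phi_y phi_o _.
set L := ln ((lam + mu) / lam).
have L0 : 0 < L by rewrite ln_gt0// ltr_pdivlMr// mul1r ltrDl.
have qE : lam / (lam + mu) = expR (- L).
  by rewrite expRN lnK ?invf_div// posrE divr_gt0// addr_gt0.
have I1_ge0 x : (0 <= I1 lam mu x)%E.
  rewrite /I1; case: ltP => [_|x0]; first exact: leey.
  by rewrite lee_fin mulr_ge0// ltW.
have near_gt0 : \forall T \near +oo, 0 < T :> R by exact: nbhs_pinfty_gt.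
split => //; split.
  move=> c c0.
  rewrite (_ : mkset _ = [set` `[0, c / L]]); first exact: segment_compact.
  apply/seteqP; split => x; rewrite /= in_itv/= /I1; case: ltP => //=.
    by rewrite lee_fin ler_pdivlMr.
  by rewrite lee_fin ler_pdivlMr.
move=> B _; split.
  apply: limf_esup_pinfty_le => e e0; set m := ereal_inf _.
  have Bm x : B x -> 0 <= x -> (m <= (x * L)%:E)%E.
    move=> Bx x0; apply: ereal_inf_lbound; exists x; first exact: subset_closure.
    by rewrite /I1 ltNge x0.
  have m0 : (0 <= m)%E by apply/ereal_infP => _ [x _ <-].
  clearbody m; case: m m0 Bm => [m| |] // m0 Bm.
    rewrite lee_fin in m0; pose x0 := m / L.
    have x00 : 0 <= x0 by rewrite divr_ge0// ltW.
    (* The first entry keeps [d] positive and the second makes [(L - d) * x0 <= e / 2]; the [+ 1]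
       covers [x0 = 0]. The other half of [e] absorbs [ln C / phi T]. *)
    pose d := maxr (L / 2) (L - e / 2 / (x0 + 1)).
    have dL : 0 < d < L.
      rewrite lt_max gt_max divr_gt0//= ltrBlDr ltrDl !divr_gt0//.
        by rewrite ltr_pdivrMr// ltr_pMr// ltr1n.
      by rewrite ltr_wpDl.
    have dx0 : m - d * x0 <= e / 2.
      have -> : m = L * x0 by rewrite mulrC divfK// gt_eqF.
      rewrite -mulrBl (@le_trans _ _ (e / 2 / (x0 + 1) * (x0 + 1)))//.
        have ltd : L - d <= e / 2 / (x0 + 1).
          by rewrite lerBlDr -lerBlDl le_max lexx orbT.
        apply: ler_pM => //; last by rewrite lerDl.
        by rewrite subr_ge0; case/andP: dL => _ /ltW.
      by rewrite divfK// gt_eqF// ltr_wpDl.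
    have [C C0 leC] := xiT_prob_upper _ _ _ _ lam0 mu0 alpha0 phi d dL.
    have near_C : \forall T \near +oo, ln C / (e / 2) <= phi T.
      exact: (cvgry_ge phi_y).
    near=> T.
    have T0 : 0 < T by near: T.
    have phiT0 : 0 < phi T by exact: phi_gt0.
    apply: (@le_trans _ _ ((phi T)^-1%:E *
        eln (C * expR (- (d * x0 * phi T)))%:E)%E).
      rewrite lee_pmul2l ?lte_fin ?invr_gt0//; apply/le_eln/leC => // x Bx x_ge0.
      by rewrite /x0 ler_pdivrMr// -lee_fin Bm.
    have P0 : 0 < C * expR (- (d * x0 * phi T)) by rewrite mulr_gt0 ?expR_gt0.
    rewrite [eln _]/= P0 -EFinM -EFinN -EFinD lee_fin lnM ?posrE ?expR_gt0// expRK.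
    rewrite mulrDr mulrN mulrC [_^-1 * _]mulrC mulfK ?gt_eqF//.
    have : ln C / phi T <= e / 2.
      rewrite ler_pdivrMr// mulrC -ler_pdivrMr ?divr_gt0//.
      by near: T.
    by move: dx0; lra.
  (* Here [m] is infinite, so [B] has no nonnegative point: the probability is 0 and [eln] sends it
     to [-oo]. *)
  near=> T.
  have T0 : 0 < T by near: T.
  have phiT0 : 0 < phi T by exact: phi_gt0.
  rewrite /xiT_prob eseries0; last first.
    move=> k _; rewrite inE => /Bm; rewrite divr_ge0 ?(ltW phiT0)//.
    by move=> /(_ isT); rewrite leNgt ltry.
  by rewrite /= ltxx gt0_muleNy ?lte_fin ?invr_gt0// leNye.
rewrite leeNl; apply/ereal_infP => _ [x Bx <-]; rewrite /I1.
case: ltP => [_|x0]; first exact: leey.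
rewrite leeNl -EFinN -/L; apply: limf_einf_pinfty_ge => e e0.
have [delta delta0 ballB] : exists2 delta, 0 < delta & ball x delta `<=` B.
  by move: Bx => /nbhs_ballP[delta delta0 ?]; exists delta.
have [c c0 low] := xiT_prob_lower _ _ _ _ lam0 mu0 alpha0 phi.
have x10 : 0 < x + 1 by rewrite ltr_wpDl.
(* Once [phi T / T <= g], the level [x * phi T] is at most [alpha * T / 4], half the exponent in the
   Poisson tail bound. *)
pose g := alpha / 4 / (x + 1).
have g0 : 0 < g by rewrite !divr_gt0.
near=> T.
have T0 : 0 < T by near: T.
have phiT0 : 0 < phi T by exact: phi_gt0.
have xphi0 : 0 <= x * phi T by rewrite mulr_ge0 ?(ltW phiT0).
(* Both [k] and [k.+1] are within 1 of [x * phi T], so after division by [phi T] they fall in the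
   ball as soon as [delta * phi T > 1]. *)
pose k := truncn (x * phi T).
have /andP[lek ltk] := truncn_itv xphi0; rewrite -/k in lek ltk.
have phi_delta : 1 < delta * phi T.
  by rewrite mulrC -ltr_pdivrMr//; near: T; exact: (cvgry_gt phi_y).
have Bk j : x * phi T - 1 <= j%:R <= x * phi T + 1 -> B (j%:R / phi T).
  move=> /andP[j1 j2]; apply: ballB; rewrite /ball/= -(ltr_pM2r phiT0).
  have -> : `|x - j%:R / phi T| * phi T = `|x * phi T - j%:R|.
    by rewrite -{2}(gtr0_norm phiT0) -normrM mulrBl divfK ?gt_eqF.
  by apply: le_lt_trans phi_delta; rewrite ler_norml; lra.
have Bk0 : B (k%:R / phi T) by apply: Bk; lra.
have Bk1 : B (k.+1%:R / phi T) by apply: Bk; move: ltk; rewrite -natr1; lra.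
(* From [2 <= expR 1] and [k <= alpha * T / 4], the product is at most [expR (- (alpha * T / 4))],
   hence at most [expR (- 1) <= 1 / 2]. *)
have half : 2 ^+ k * expR (- (alpha * T / 2)) <= 1 / 2.
  have two_le_e : 2 <= expR 1 :> R by apply: le_trans (expR_ge1Dx _).
  have xT : x * phi T <= alpha * T / 4.
    apply: (@le_trans _ _ ((x + 1) * phi T)); first by rewrite ler_pM2r ?lerDl.
    have -> : alpha * T / 4 = (x + 1) * (g * T).
      by rewrite /g; field; rewrite gt_eqF.
    rewrite ler_pM2l// -ler_pdivrMr//; near: T.
    by apply: (cvgr_le _ phi_o).
  have T_large : 1 <= alpha * T / 4.
    by rewrite ler_pdivlMr// mul1r mulrC -ler_pdivrMr//; near: T.
  apply: (@le_trans _ _ (expR k%:R * expR (- (alpha * T / 2)))).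
    rewrite ler_pM2r ?expR_gt0// -[k%:R]mulr1 expRM_natl.
    by rewrite lerXn2r ?nnegrE ?expR_ge0.
  rewrite -expRD (@le_trans _ _ (expR (- 1)))//; first by rewrite ler_expR; lra.
  by rewrite expRN div1r lef_pV2 ?posrE ?expR_gt0.
have := low T B k T0 Bk0 Bk1; rewrite qE => lowT.
(* The factor 1/2 comes from [half], and [k <= x * phi T] allows [k] to be replaced in the exponent;
   [ln (c / 2) / phi T] is eventually at least [- e]. *)
apply: (@le_trans _ _ ((phi T)^-1%:E * eln (c / 2 * expR (- L * (x * phi T)))%:E)%E).
  have P0 : 0 < c / 2 * expR (- L * (x * phi T)) by rewrite !mulr_gt0 ?expR_gt0.
  rewrite [eln _]/= P0 -EFinM lee_fin lnM ?posrE ?expR_gt0 ?divr_gt0// expRK.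
  rewrite mulrDr [leRHS]addrC.
  rewrite (_ : (phi T)^-1 * (- L * (x * phi T)) = - (x * L)); last first.
    by field; rewrite gt_eqF.
  rewrite lerD2l lerNl -mulrN [leLHS]mulrC ler_pdivrMr// [leRHS]mulrC -ler_pdivrMr//.
  by near: T; exact: (cvgry_ge phi_y).
rewrite lee_pmul2l ?lte_fin ?invr_gt0//; apply/le_eln; apply: le_trans lowT.
rewrite lee_fin mulrAC; apply: ler_pM.
- by rewrite mulr_ge0 ?expR_ge0 ?ltW.
- by rewrite invr_ge0.
- rewrite ler_pM2l// -expRM_natl ler_expR mulrN mulNr lerN2.
  by rewrite mulrC ler_pM2l.
- by move: half; lra.
Unshelve. all: by end_near. Qed.
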